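(* The pattern $\{(1,2),(1,3),(1,4),(2,1),(3,4),(4,3)\}$ is $4$-universal.
   Context: Let $L(4)$ be the space of traceless complex $4\times4$ matrices. For a set $I\subseteq\{1,2,3,4\}^2$, let $L_I(4)$ be the subspace of all $X=[x_{ij}]\in L(4)$ with $x_{ij}=0$ for all $(i,j)\in I$. The pattern $I$ is $4$-universal if every matrix in $L(4)$ is unitarily similar (by an element of $\mathrm{U}(4)$) to a matrix in $L_I(4)$. *)

(* Defs.v *)
From mathcomp Require Import all_boot all_order all_algebra.
From mathcomp Require Import reals.
From mathcomp Require Import complex.

Set Implicit Arguments.
Unset Strict Implicit.
Unset Printing Implicit Defensive.

Import Order.TTheory GRing.Theory Num.Theory.
Local Open Scope ring_scope.
Local Open Scope sesquilinear_scope.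

Definition traceless (C : numClosedFieldType) (n : nat) : {pred 'M[C]_n} :=
  [pred X : 'M[C]_n | \tr X == 0].

Definition traceless_zero_on (C : numClosedFieldType) (n : nat)
    (I : {set 'I_n * 'I_n}) : {pred 'M[C]_n} :=
  [pred X : 'M[C]_n | (X \in @traceless C n) &&
                      [forall ij in I, X ij.1 ij.2 == 0]].

Definition unitarily_similar (C : numClosedFieldType) (n : nat)
    (A B : 'M[C]_n) : Prop :=
  similar_in unitarymx A B.

(* [similar_in] goes through the pseudo-inverse [pinvmx]; on unitary matrices
   this is the conjugate transpose. *)
Lemma unitarily_similarE (C : numClosedFieldType) (n : nat) (A B : 'M[C]_n) :
  unitarily_similar A B <->
  exists2 U : 'M[C]_n, U \is unitarymx & B = U *m A *m U ^t*.
Proof.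
have conjE (U : 'M[C]_n) : U \is unitarymx -> conjmx U A = U *m A *m U ^t*.
  by move=> Uu; rewrite conjumx ?unitarymx_unit// invmx_unitary.
split=> -[U Uu].
  by rewrite /similar_to /= conjE // => /eqP <-; exists U.
by move=> ->; exists U => //; rewrite /similar_to /= conjE.
Qed.

Definition universal (C : numClosedFieldType) (n : nat)
    (I : {set 'I_n * 'I_n}) : Prop :=
  forall X : 'M[C]_n, X \in @traceless C n ->
  exists2 Y : 'M[C]_n, Y \in @traceless_zero_on C n I & unitarily_similar X Y.

(* Positions are listed 1-based, whereas ['I_n] is 0-based. *)
Definition pattern (n : nat) (s : seq (nat * nat)) : {set 'I_n * 'I_n} :=
  [set ij : 'I_n * 'I_n | ((ij.1).+1, (ij.2).+1) \in s].

(* Main.v *)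
(* By Schur, [X] may be assumed lower triangular, so its first row is already
   cleared. Let [b] be the rest of its first column and [M] the lower right
   3x3 block. It remains to find an orthonormal basis [e2, e3, e4] of C^3 with
   [e2] orthogonal to [b] and with the compression of [M] to <e3, e4> diagonal;
   so we need a plane through [b] on which the compression of [M] is normal.
   A 2x2 matrix [N] is normal iff [u N] is hermitian up to scalars for some
   [u != 0]. Turn coordinates so that [b] lies along the third basis vector.
   For given [u], equality of the off-diagonal entries of [u N] and [(u N)^*]
   determines the second basis vector of the plane, up to scaling, as a function
   which is real-linear in [u]; reality of [u (N_11 - N_22)] is then a real binary
   cubic equation in [(Re u, Im u)], and such an equation has a nonzero solution.
   All changes of basis are Givens rotations. *)

Require Import Defs.
From mathcomp Require Import all_boot all_order all_algebra.
From mathcomp Require Import reals.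
From mathcomp Require Import complex.
From mathcomp Require Import ring lra.

Set Implicit Arguments.
Unset Strict Implicit.
Unset Printing Implicit Defensive.

Import Order.TTheory GRing.Theory Num.Theory.
Local Open Scope ring_scope.
Local Open Scope sesquilinear_scope.

(** * Givens rotations and unitary similarity *)

Section Givens.
Variables (C : numClosedFieldType) (n : nat).
Implicit Types (A B D : 'M[C]_n) (i j k l : 'I_n) (a b : C).

Lemma unitarily_similar_trans A B D :
  unitarily_similar A B -> unitarily_similar B D -> unitarily_similar A D.
Proof.
move=> /unitarily_similarE[U Uu ->] /unitarily_similarE[V Vu ->].
apply/unitarily_similarE; exists (V *m U); first exact: mul_unitarymx.
by rewrite trmx_mul map_mxM !mulmxA.
Qed.

Lemma unitarily_similar_traceless A B :
  unitarily_similar A B -> (B \in @traceless C n) = (A \in @traceless C n).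
Proof.
move=> /unitarily_similarE[U Uu ->]; rewrite !inE.
by rewrite mxtrace_mulC mulmxA -invmx_unitary // mulVmx ?unitarymx_unit ?mul1mx.
Qed.

Definition givens i j a b : 'M[C]_n :=
  \matrix_(k < n) if k == i then a *: delta_mx 0 i + b *: delta_mx 0 j
    else if k == j then - b^* *: delta_mx 0 i + a^* *: delta_mx 0 j
    else delta_mx 0 k.

Lemma mul_givensE i j a b A k l :
  (givens i j a b *m A) k l =
    if k == i then a * A i l + b * A j l
    else if k == j then - b^* * A i l + a^* * A j l else A k l.
Proof.
have -> : (givens i j a b *m A) k l = row k (givens i j a b *m A) 0 l by rewrite [RHS]mxE.
by rewrite row_mul rowK; do 2?case: eqP => _;
  rewrite ?mulmxDl -?scalemxAl -?rowE ?mxE.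
Qed.

Lemma mul_givens_adjE i j a b A k l :
  (A *m (givens i j a b)^t*) k l =
    if l == i then a^* * A k i + b^* * A k j
    else if l == j then - b * A k i + a * A k j else A k l.
Proof.
have -> : A *m (givens i j a b)^t* = (givens i j a b *m A^t*)^t*.
  by rewrite trmx_mul map_mxM trmxCK.
rewrite [LHS]mxE [X in X^*]mxE mul_givensE !mxE.
by do 2?case: eqP => _; rewrite ?rmorphD ?rmorphM ?rmorphN /= ?conjCK.
Qed.

Lemma givens_unitary i j a b : i != j -> a * a^* + b * b^* = 1 ->
  givens i j a b \is unitarymx.
Proof.
move=> ij ab1; apply/unitarymxP/matrixP => k l.
have -> : (givens i j a b)^t* = 1%:M *m (givens i j a b)^t* by rewrite mul1mx.
rewrite !(mul_givensE, mul_givens_adjE) !mxE !(eq_sym _ l).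
have ji : (j == i) = false by rewrite eq_sym (negPf ij).
have [->|ki] := eqVneq k i; last have [->|kj] := eqVneq k j.
all: (have [lE|li] := eqVneq l i; last have [lE|lj] := eqVneq l j).
all: rewrite ?lE ?eqxx ?ji ?(negPf ij) ?(negPf ki) ?(negPf kj) /= ?mulr0n ?mulr1n.
all: rewrite ?(eq_sym _ k) ?(negPf ki) ?(negPf kj) ?mulr0n ?mulr1 ?mulr0.
all: by rewrite -?ab1; ring.
Qed.

Definition rotate i j a b A := givens i j a b *m A *m (givens i j a b)^t*.

Lemma rotateE i j a b A k l : rotate i j a b A k l =
  if l == i then a^* * (if k == i then a * A i i + b * A j i
      else if k == j then - b^* * A i i + a^* * A j i else A k i)
    + b^* * (if k == i then a * A i j + b * A j j
      else if k == j then - b^* * A i j + a^* * A j j else A k j)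
  else if l == j then - b * (if k == i then a * A i i + b * A j i
      else if k == j then - b^* * A i i + a^* * A j i else A k i)
    + a * (if k == i then a * A i j + b * A j j
      else if k == j then - b^* * A i j + a^* * A j j else A k j)
  else if k == i then a * A i l + b * A j l
    else if k == j then - b^* * A i l + a^* * A j l else A k l.
Proof. by rewrite mul_givens_adjE !mul_givensE. Qed.

Lemma rotate_similar i j a b A : i != j -> a * a^* + b * b^* = 1 ->
  unitarily_similar A (rotate i j a b A).
Proof.
move=> ij ab1; apply/unitarily_similarE.
by exists (givens i j a b); first exact: givens_unitary.
Qed.

Lemma rotate_row_eq0 i j a b A k : k != i -> k != j ->
  (forall l, l != k -> A k l = 0) -> forall l, l != k -> rotate i j a b A k l = 0.
Proof.
move=> ki kj Ak0 l lk; rewrite rotateE (negPf ki) (negPf kj).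
by rewrite !Ak0 ?(eq_sym i) ?(eq_sym j) // !mulr0 addr0 !if_same.
Qed.

Lemma rotate_col_eq0 i j a b A k : k != i -> k != j -> A i k = 0 -> A j k = 0 ->
  rotate i j a b A i k = 0 /\ rotate i j a b A j k = 0.
Proof.
move=> ki kj Ai Aj; rewrite !rotateE (negPf ki) (negPf kj) !eqxx Ai Aj.
by rewrite !mulr0 addr0 if_same.
Qed.

End Givens.

(** * Nonzero roots of homogeneous equations *)

(* On the path [(t, 1 - t^2)] from [(-1, 0)] to [(1, 0)], which avoids the origin,
   the cubic form takes opposite values at the two ends. *)
Lemma binary_cubic_root (R : rcfType) (a b c d : R) :
  exists x y : R, (x != 0) || (y != 0) /\
    a * x ^+ 3 + b * x ^+ 2 * y + c * x * y ^+ 2 + d * y ^+ 3 = 0.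
Proof.
pose p : {poly R} := a *: 'X^3 + b *: ('X^2 * (1 - 'X^2))
  + c *: ('X * (1 - 'X^2) ^+ 2) + d *: (1 - 'X^2) ^+ 3.
have pE t : p.[t] = a * t ^+ 3 + b * t ^+ 2 * (1 - t ^+ 2)
    + c * t * (1 - t ^+ 2) ^+ 2 + d * (1 - t ^+ 2) ^+ 3.
  rewrite /p !hornerE /=; ring.
have [t] : exists t, p.[t] = 0.
  have le11 : (-1 : R) <= 1 by rewrite lerNl; lra.
  have [a0|a0] := leP 0 a.
    have [|t _ /rootP] := @poly_ivt _ p _ _ le11; last by exists t.
    by rewrite !pE; apply/andP; split; lra.
  have [|t _ /rootP] := @poly_ivt _ (- p) _ _ le11.
    by rewrite !hornerN !pE; apply/andP; split; lra.
  by rewrite hornerN => /eqP; rewrite oppr_eq0 => /eqP; exists t.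
rewrite pE => pt; exists t, (1 - t ^+ 2); split=> //.
case: (eqVneq t 0) => //= ->; by rewrite expr0n subr0 oner_neq0.
Qed.

Lemma quadratic_root (C : numClosedFieldType) (a b c : C) :
  exists x y : C, (x != 0) || (y != 0) /\
    a * x ^+ 2 + b * x * y + c * y ^+ 2 = 0.
Proof.
have [->|a0] := eqVneq a 0.
  by exists 1, 0; rewrite oner_neq0; split => //; ring.
(* The quadratic formula in homogeneous form: its denominator becomes the second coordinate. *)
exists (- b + sqrtC (b ^+ 2 - 4 * a * c)), (2 * a); split.
  by rewrite mulf_neq0 ?orbT ?pnatr_eq0.
have := sqrtCK (b ^+ 2 - 4 * a * c).
set r := sqrtC _ => rK.
have -> : c * (2 * a) ^+ 2 = a * (b ^+ 2 - r ^+ 2) by rewrite rK; ring.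
ring.
Qed.

(** Turns a root of a homogeneous equation into the parameters of a rotation. As [s] is real, it
    also factors out of conjugates. *)
Lemma unit_rescaling (C : numClosedFieldType) (x y : C) :
  (x != 0) || (y != 0) ->
  exists2 s : C, s^* = s & (s * x) * (s * x)^* + (s * y) * (s * y)^* = 1.
Proof.
move=> xy; set N := x * x^* + y * y^*.
have N0 : 0 < N.
  rewrite /N -!normCK; case/orP: xy => h.
    by rewrite ltr_pwDl ?exprn_gt0 ?normr_gt0 ?exprn_ge0.
  by rewrite ltr_wpDl ?exprn_gt0 ?normr_gt0 ?exprn_ge0.
have sR : (sqrtC N)^-1^* = (sqrtC N)^-1.
  by apply/CrealP; rewrite ger0_real // invr_ge0 sqrtC_ge0 ltW.
exists (sqrtC N)^-1 => //; rewrite !rmorphM /= sR.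
have -> : forall s, s * x * (s * x^*) + s * y * (s * y^*) = s ^+ 2 * N.
  by move=> s; rewrite /N; ring.
by rewrite exprVn sqrtCK mulVf ?gt_eqF.
Qed.

(** Writing [Q] for the quadratic form, the imaginary part of the product is [x * Im Q + y * Re Q],
    a real binary cubic in [x] and [y]. *)
Lemma real_on_plane (R : rcfType) (a b c : R[i]) :
  exists x y : R[i], [/\ x^* = x, y^* = y, (x != 0) || (y != 0) &
    (x + 'i * y) * (x ^+ 2 * a + x * y * b + y ^+ 2 * c) \is Num.real].
Proof.
have [x [y [xy0 xyE]]] := binary_cubic_root (complex.Im a)
  (complex.Im b + complex.Re a) (complex.Im c + complex.Re b) (complex.Re c).
exists (x%:C)%C, (y%:C)%C; split.
- by apply/CrealP; rewrite complex_real.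
- by apply/CrealP; rewrite complex_real.
- by rewrite !eq_complex /= eqxx !andbT.
rewrite -complexiE; move: xyE; case: a b c => [a a'] [b b'] [c c'] /= xyE.
by simpc; rewrite complex_real -xyE; apply/eqP; ring.
Qed.

Lemma linear_form_root (K : fieldType) (a b : K) :
  exists x y : K, (x != 0) || (y != 0) /\ a * x + b * y = 0.
Proof.
have [->|a0] := eqVneq a 0.
  by exists 1, 0; rewrite oner_neq0; split => //; ring.
by exists (- b), a; rewrite a0 orbT; split => //; ring.
Qed.

(** * Rotations that clear entries or make a block normal *)

Lemma rotate_clear_entry (C : numClosedFieldType) n (i j k : 'I_n) (A : 'M[C]_n) :
  i != j -> k != i -> k != j ->
  exists a b, a * a^* + b * b^* = 1 /\ rotate i j a b A j k = 0.
Proof.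
move=> ij ki kj.
(* The entry to clear is [a^* * A j k - b^* * A i k]; this form is its conjugate. *)
have [x [y [xy0 xyE]]] := linear_form_root (A j k)^* (- (A i k)^*).
have [s sR s1] := unit_rescaling xy0.
exists (s * x), (s * y); split=> //.
rewrite rotateE // (negPf ki) (negPf kj) eqxx eq_sym (negPf ij).
have := congr1 (fun z => s * z^*) xyE.
rewrite !rmorphD !rmorphM !rmorphN /= !conjCK sR conjC0 mulr0 => <-; ring.
Qed.

(** The plane sought is spanned by the fixed vector [k] and the new vector [i]; the new vector [j]
    is its orthogonal complement among the three. *)
Lemma rotate_normal_block (R : rcfType) n (i j k : 'I_n) (A : 'M[R[i]]_n) :
  i != j -> k != i -> k != j ->
  exists a b u, let B := rotate i j a b A in
  [/\ a * a^* + b * b^* = 1, u != 0, u * (B k k - B i i) \is Num.real &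
      u * B k i = (u * B i k)^*].
Proof.
move=> ij ki kj.
have iI : 'i^* = - 'i :> R[i] by exact: conjCi.
(* The difference [B k k - B i i], made homogeneous through [a * a^* + b * b^* = 1] and polarized:
   linear in [(a, b)], conjugate-linear in [(c, d)]. *)
pose q a b c d : R[i] := A k k * (a * c^* + b * d^*)
  - (c^* * (a * A i i + b * A j i) + d^* * (a * A i j + b * A j j)).
have BE a b : a * a^* + b * b^* = 1 -> let B := rotate i j a b A in
    [/\ B k k - B i i = q a b a b, B k i = a^* * A k i + b^* * A k j
      & B i k = a * A i k + b * A j k].
  by move=> ab1 /=; rewrite !rotateE ?eqxx ?(negPf ki) ?(negPf kj) /q ab1 mulr1.
pose a1 := (A k j)^* - A j k; pose a2 := - 'i * ((A k j)^* + A j k).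
pose b1 := A i k - (A k i)^*; pose b2 := 'i * ((A k i)^* + A i k).
have [x [y [xR yR xy0 xyE]]] := real_on_plane
  (q a1 b1 a1 b1) (q a1 b1 a2 b2 + q a2 b2 a1 b1) (q a2 b2 a2 b2).
have qE s c1 c2 d1 d2 : s^* = s ->
    let c := s * (x * c1 + y * c2) in let d := s * (x * d1 + y * d2) in
    q c d c d = s ^+ 2 * (x ^+ 2 * q c1 d1 c1 d1
      + x * y * (q c1 d1 c2 d2 + q c2 d2 c1 d1) + y ^+ 2 * q c2 d2 c2 d2).
  by move=> sR /=; rewrite /q !rmorphM !rmorphD !rmorphM /= sR xR yR; ring.
pose u := x + 'i * y; pose a := x * a1 + y * a2; pose b := x * b1 + y * b2.
have uC : u^* = x - 'i * y by rewrite rmorphD rmorphM /= xR yR iI; ring.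
have u0 : u != 0.
  apply: contraL xy0 => /eqP u0; rewrite negb_or !negbK.
  have x0 : x = 0.
    have : 2 * x = u + u^* by rewrite uC /u; ring.
    by rewrite u0 conjC0 addr0 => /eqP; rewrite mulf_eq0 pnatr_eq0 => /eqP.
  by move: u0 => /eqP; rewrite /u x0 eqxx add0r mulf_eq0 (negPf (neq0Ci _)).
have aE : a = u^* * (A k j)^* - u * A j k by rewrite uC /a /a1 /a2 /u; ring.
have bE : b = u * A i k - u^* * (A k i)^* by rewrite uC /b /b1 /b2 /u; ring.
(* If [a = b = 0], then [(A i k, A j k)] is proportional to the conjugate of
   [(A k i, A k j)], so that one rotation kills both off-diagonal entries. *)
have [ab0|/norP[]] := boolP ((a != 0) || (b != 0)); last first.
  rewrite !negbK => /eqP a0 /eqP b0.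
  have [c [d [cd0 cdE]]] := linear_form_root (A k i)^* (A k j)^*.
  have [s sR s1] := unit_rescaling cd0.
  have cdE' : A i k * c + A j k * d = 0.
    apply: (mulfI u0); rewrite mulr0 -(mulr0 u^*) -cdE.
    move: a0 b0; rewrite aE bE => /subr0_eq a0 /subr0_eq b0.
    by rewrite !mulrDr !mulrA a0 b0.
  have [E1 E2 E3] := BE _ _ s1.
  set e := q _ _ _ _ in E1.
  (* With both off-diagonal entries zero, [u] only has to make [u * e] real. *)
  exists (s * c), (s * d), (if e == 0 then 1 else e^*) => /=.
  rewrite E1 E2 E3; split=> //.
  - by have [_|e0] := eqVneq e 0; rewrite ?oner_neq0 // conjC_eq0.
  - have [->|_] := eqVneq e 0; first by rewrite mulr0 real0.
    by rewrite mulrC -normCK rpredX // normr_real.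
  - have -> : s * c * A i k + s * d * A j k = s * (A i k * c + A j k * d) by ring.
    rewrite cdE' !mulr0 conjC0.
    have -> : (s * c)^* * A k i + (s * d)^* * A k j
      = s * ((A k i)^* * c + (A k j)^* * d)^*.
      by rewrite rmorphD !rmorphM /= !conjCK sR; ring.
    by rewrite cdE conjC0 !mulr0.
have [s sR s1] := unit_rescaling ab0.
have [E1 E2 E3] := BE _ _ s1.
exists (s * a), (s * b), u => /=; rewrite E1 E2 E3; split=> //.
  have sr : s \is Num.real by apply/CrealP.
  by rewrite qE // mulrCA rpredM ?rpredX.
have aC : a^* = u * A k j - u^* * (A j k)^*.
  by rewrite aE rmorphB !rmorphM /= !conjCK.
have bC : b^* = u^* * (A i k)^* - u * (A k i)^*^*.
  by rewrite bE rmorphB !rmorphM /= !conjCK.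
rewrite conjCK in bC; clearbody u a b.
by rewrite !rmorphM !rmorphD !rmorphM /= sR aC bC; ring.
Qed.

Lemma rotate_diagonalize_block (C : numClosedFieldType) n (i j : 'I_n) (A : 'M[C]_n) u :
  i != j -> u != 0 -> u * (A i i - A j j) \is Num.real ->
  u * A i j = (u * A j i)^* ->
  exists a b, [/\ a * a^* + b * b^* = 1, rotate i j a b A i j = 0 &
    rotate i j a b A j i = 0].
Proof.
move=> ij u0 /CrealP dR hE.
have [x [y [xy0 xyE]]] := quadratic_root (A i j) (A j j - A i i) (- A j i).
have [s sR s1] := unit_rescaling xy0.
exists (s * x), (s * y); split=> //.
  rewrite rotateE !eqxx (eq_sym j) (negPf ij) -(mulr0 (s ^+ 2)) -xyE; ring.
apply: (mulfI u0); rewrite rotateE !eqxx (eq_sym j) (negPf ij) mulr0.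
have [h hD] : exists h, h = u * A j i by exists (u * A j i).
have [r rD] : exists r, r = u * (A i i - A j j) by exists (u * (A i i - A j j)).
rewrite -hD in hE; rewrite -rD in dR.
(* By hermitian symmetry, [u] times the second off-diagonal entry is the conjugate of [u] times the
   first, so a single quadratic equation clears both. *)
have : h^* * x ^+ 2 - r * x * y - h * y ^+ 2 = 0.
  by rewrite -hE -(mulr0 u) -xyE hD rD; ring.
move=> /(congr1 (fun z => s ^+ 2 * z^*)).
rewrite !rmorphB !rmorphM /= conjCK dR -hE conjC0 mulr0 => <-.
rewrite sR hD rD; ring.
Qed.

Theorem proposition7p3 (R : realType) :
  @universal (complex R) 4
    (pattern 4 [:: (1, 2); (1, 3); (1, 4); (2, 1); (3, 4); (4, 3)]%N).
Proof.
move=> X X0.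
pose o0 : 'I_4 := @Ordinal 4 0 isT; pose o1 : 'I_4 := @Ordinal 4 1 isT.
pose o2 : 'I_4 := @Ordinal 4 2 isT; pose o3 : 'I_4 := @Ordinal 4 3 isT.
have [U Uu trigT] := @Schur _ _ X isT; rewrite /similar_to conjymx // in trigT.
set T := U *m X *m U^t* in trigT.
have XT : unitarily_similar X T by apply/unitarily_similarE; exists U.
have T0 l : l != o0 -> T o0 l = 0.
  by move=> l0; have /is_trig_mxP-> := trigT; rewrite // lt0n.
have [A1 [S1 A1_0 A1_30]] : exists A1, [/\ unitarily_similar T A1,
    forall l, l != o0 -> A1 o0 l = 0 & A1 o3 o0 = 0].
  have [a [b [ab1 A0]]] := rotate_clear_entry T (isT : o2 != o3) (isT : o0 != o2) isT.
  exists (rotate o2 o3 a b T); split; first exact: rotate_similar; last by [].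
  exact: rotate_row_eq0.
have [A2 [S2 A2_0 A2_10 A2_30]] : exists A2, [/\ unitarily_similar A1 A2,
    forall l, l != o0 -> A2 o0 l = 0, A2 o1 o0 = 0 & A2 o3 o0 = 0].
  have [a [b [ab1 A0]]] := rotate_clear_entry A1 (isT : o2 != o1) (isT : o0 != o2) isT.
  exists (rotate o2 o1 a b A1); split; [exact: rotate_similar | | by [] | ].
    exact: rotate_row_eq0.
  by rewrite rotateE.
have [A3 [u [S3 A3_0 A3_10 [u0 uR uH]]]] : exists A3 u,
    [/\ unitarily_similar A2 A3, forall l, l != o0 -> A3 o0 l = 0, A3 o1 o0 = 0 &
     [/\ u != 0, u * (A3 o2 o2 - A3 o3 o3) \is Num.real
       & u * A3 o2 o3 = (u * A3 o3 o2)^*]].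
  (* Column [o0] already vanishes in rows [o3] and [o1], so mixing these two keeps it zero there. *)
  have [a [b [u [ab1 u0 uR uH]]]] :=
    rotate_normal_block A2 (isT : o3 != o1) (isT : o2 != o3) isT.
  exists (rotate o3 o1 a b A2), u; split; [exact: rotate_similar | | | by []].
    exact: rotate_row_eq0.
  by have [] := rotate_col_eq0 a b (isT : o0 != o3) (isT : o0 != o1) A2_30 A2_10.
have [Y [S4 Y0 Y10 [Y23 Y32]]] : exists Y, [/\ unitarily_similar A3 Y,
    forall l, l != o0 -> Y o0 l = 0, Y o1 o0 = 0 & Y o2 o3 = 0 /\ Y o3 o2 = 0].
  (* This may refill the entry at [(o3, o0)], which the pattern leaves free; row [o1] of column [o0]
     is untouched. *)
  have [a [b [ab1 Y23 Y32]]] := rotate_diagonalize_block (isT : o2 != o3) u0 uR uH.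
  exists (rotate o2 o3 a b A3); split; [exact: rotate_similar | | | by []].
    exact: rotate_row_eq0.
  by rewrite rotateE.
have XY : unitarily_similar X Y.
  exact: unitarily_similar_trans XT (unitarily_similar_trans S1
    (unitarily_similar_trans S2 (unitarily_similar_trans S3 S4))).
exists Y => //; rewrite inE (unitarily_similar_traceless XY) X0 /=.
apply/forall_inP => -[k l]; rewrite inE /= !inE !xpair_eqE !eqSS => kl.
have : [|| (k == o0) && (l == o1), (k == o0) && (l == o2), (k == o0) && (l == o3),
    (k == o1) && (l == o0), (k == o2) && (l == o3) | (k == o3) && (l == o2)] by [].
by case/or4P => [||| /or3P[]] /andP[/eqP-> /eqP->]; apply/eqP => //; apply: Y0.
Qed.
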